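(* Let $n$ be a positive integer. The Labelle merging algorithm $$(P,Q)\longmapsto U\,p_1\,q_1'\,p_2\,q_2'\cdots p_{2n}\,q_{2n}'\,D,$$ where $P=p_1p_2\cdots p_{2n}$, $Q=q_1q_2\cdots q_{2n}$, and $U'=D$, $D'=U$, is a bijection between the set of pairs $(P,Q)$ of noncrossing free Dyck paths of length $2n$ and the set of Dyck paths of length $4n+2$ with exactly $n+1$ up steps at odd positions.
   Context: A free Dyck path of length $2n$ is a lattice path from $(0,0)$ to $(2n,0)$ with up steps $U=(1,1)$ and down steps $D=(1,-1)$, represented as a sequence of $n$ letters $U$ and $n$ letters $D$; it is allowed to go below the $x$-axis. A Dyck path is a free Dyck path that never goes below the $x$-axis. A pair of noncrossing free Dyck paths of length $2n$ is an ordered pair $(P,Q)$ of free Dyck paths of length $2n$ such that $P$ never goes below $Q$ (they may touch or share steps). The steps of a path are numbered by positions $1,2,3,\ldots$ from left to right; an up step at an odd position is a letter $U$ occurring as the $i$-th step with $i$ odd. *)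

(* Defs.v *)
From HB Require Import structures.
From mathcomp Require Import all_boot all_order all_algebra.
From mathcomp Require Import classical_sets functions.

Set Implicit Arguments.
Unset Strict Implicit.
Unset Printing Implicit Defensive.

Inductive step : Set := U | D.

Definition is_up (s : step) : bool := if s is U then true else false.
Definition step_of_bool (b : bool) : step := if b then U else D.

Lemma is_upK : cancel is_up step_of_bool.
Proof. by case. Qed.

HB.instance Definition _ := Equality.copy step (can_type is_upK).

Definition flip (s : step) : step := if s is U then D else U.

Definition height (w : seq step) : int :=
  ((count_mem U w)%:Z - (count_mem D w)%:Z)%R.

(* The parameter n is the semilength: the path has length 2n. *)
Definition free_dyck (n : nat) (w : seq step) : Prop :=
  count_mem U w = n /\ count_mem D w = n.

(* Paths are linear between consecutive integer abscissas, so heights need only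
   be compared there, in dyck as well as in never_below. *)
Definition dyck (n : nat) (w : seq step) : Prop :=
  free_dyck n w /\
  forall i : nat, i <= size w -> (0 <= height (take i w))%R.

Definition never_below (P Q : seq step) : Prop :=
  forall i : nat, i <= size P -> (height (take i Q) <= height (take i P))%R.

Definition noncrossing_pairs (n : nat) : set (seq step * seq step) :=
  [set PQ | [/\ free_dyck n PQ.1, free_dyck n PQ.2 & never_below PQ.1 PQ.2]].

(* Positions are numbered from 1, hence the predecessor in the 0-based nth. *)
Definition odd_ups (w : seq step) : nat :=
  count (fun i => odd i && (nth D w i.-1 == U)) (iota 1 (size w)).

Definition dyck_odd_ups (m k : nat) : set (seq step) :=
  [set w | dyck m w /\ odd_ups w = k].

Definition labelle_merge (PQ : seq step * seq step) : seq step :=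
  U :: flatten [seq [:: pq.1; flip pq.2] | pq <- zip PQ.1 PQ.2] ++ [:: D].

(* Main.v *)
(** The letters [p_i] and [q_i'] sit at positions [2i] and [2i+1] of the merged
    word, so its height after [2k+1] steps is [1 + h_k(P) - h_k(Q)].  Prefixes of
    [P] and [Q] of the same length have heights of the same parity, so this number
    is odd and is nonnegative exactly when [h_k(P) >= h_k(Q)]; heights after an
    even number of steps are then nonnegative as well.  The up steps at odd
    positions are the initial [U] and the flipped down steps of [Q].  Conversely a
    Dyck path starts with [U] and ends with [D], and its middle part splits
    uniquely into its letters at even and at odd positions. *)
Require Import Defs.
From mathcomp Require Import all_boot all_order all_algebra.
From mathcomp Require Import classical_sets functions.
From mathcomp Require Import zify.

(** The merged word without its outer [U] and [D], isolated so that inductions can peel off one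
    letter of each path at a time. *)
Definition interleave (P Q : seq step) : seq step :=
  flatten [seq [:: pq.1; flip pq.2] | pq <- zip P Q].

Lemma flipK : involutive flip.
Proof. by case. Qed.

Lemma eq_stepE :
  (((U == U) = true) * ((U == D) = false)) * (((D == U) = false) * ((D == D) = true)).
Proof. by []. Qed.

Lemma count_steps (w : seq step) : count_mem U w + count_mem D w = size w.
Proof. by elim: w => //= -[] w; rewrite ?eq_stepE; lia. Qed.

Lemma free_dyck_size {n w} : free_dyck n w -> size w = 2 * n.
Proof. by case=> cU cD; rewrite -count_steps; lia. Qed.

Lemma height_cat (v w : seq step) : height (v ++ w) = (height v + height w)%R.
Proof. by rewrite /height !count_cat; lia. Qed.

Lemma height_cons s (w : seq step) : height (s :: w) = (height [:: s] + height w)%R.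
Proof. exact: (height_cat [:: s]). Qed.

Lemma height_size (w : seq step) :
  height w = ((size w)%:Z - 2 * (count_mem D w)%:Z)%R.
Proof. by rewrite /height -count_steps; lia. Qed.

Lemma height_free_dyck {n w} : free_dyck n w -> height w = 0%R.
Proof. by rewrite /height => -[-> ->]; lia. Qed.

Lemma height_take_succ (w : seq step) j :
  (height (take j w) - 1 <= height (take j.+1 w))%R.
Proof.
case: (ltnP j (size w)) => hj.
  by rewrite (take_nth D hj) -cats1 height_cat; case: (nth _ _ _); rewrite /height /= ?eq_stepE; lia.
by rewrite !take_oversize; lia.
Qed.

Lemma count_U_interleave P Q : size P = size Q ->
  count_mem U (interleave P Q) = count_mem U P + count_mem D Q.
Proof.
elim: P Q => [|p P IH] [|q Q] //= [/IH]; rewrite /interleave /= => ->.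
by case: p; case: q; rewrite /= ?eq_stepE; lia.
Qed.

Lemma size_interleave P Q : size P = size Q -> size (interleave P Q) = 2 * size P.
Proof. by elim: P Q => [|p P IH] [|q Q] //= [/IH]; rewrite /interleave /=; lia. Qed.

Lemma count_D_interleave P Q : size P = size Q ->
  count_mem D (interleave P Q) = count_mem D P + count_mem U Q.
Proof.
move=> eqPQ; have := count_steps (interleave P Q).
rewrite count_U_interleave // size_interleave //.
by have := count_steps P; have := count_steps Q; lia.
Qed.

Lemma height_interleave P Q : size P = size Q ->
  height (interleave P Q) = (height P - height Q)%R.
Proof.
by move=> eqPQ; rewrite /height count_U_interleave // count_D_interleave //; lia.
Qed.

Lemma take_interleave P Q k :
  take (2 * k) (interleave P Q) = interleave (take k P) (take k Q).
Proof.
elim: P Q k => [|p P IH] [|q Q] k; try by rewrite /interleave; case: k.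
case: k => [|k]; first by rewrite muln0 !take0.
have -> : 2 * k.+1 = (2 * k).+2 by lia.
by rewrite /interleave /= -/(interleave _ _) IH.
Qed.

Lemma interleave_inj {P Q P' Q'} : size P = size Q -> size P' = size Q' ->
  interleave P Q = interleave P' Q' -> P = P' /\ Q = Q'.
Proof.
elim: P Q P' Q' => [|p P IH] [|q Q] [|p' P'] [|q' Q'] //= [sPQ] [sPQ'].
rewrite /interleave /= => -[-> /(can_inj flipK)-> eqM].
by have [-> ->] := IH _ _ _ sPQ sPQ' eqM.
Qed.

Lemma interleave_surj {k} {w : seq step} : size w = 2 * k ->
  exists P Q, [/\ size P = k, size Q = k & w = interleave P Q].
Proof.
elim: k w => [|k IH] w sw; first by exists [::], [::]; split=> //; apply: size0nil.
case: w sw => [|p [|q w]] /= sw; [lia | lia |].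
have [P [Q [sP sQ ->]]] := IH w ltac:(lia).
by exists (p :: P), (flip q :: Q); rewrite /interleave /= flipK sP sQ.
Qed.

(** A shift of positions by two keeps their parity, and [y] stands at an even position. *)
Lemma odd_ups_cons2 x y w : odd_ups [:: x, y & w] = (x == U) + odd_ups w.
Proof.
rewrite /odd_ups /= add0n; congr addn.
rewrite (iotaDl 2) count_map; apply: eq_in_count => i.
by rewrite mem_iota /= negbK; case: i.
Qed.

(** The first letter [x] is arbitrary for the sake of the induction: once [x] and [p] are removed,
    [flip q] takes the place of [x]. *)
Lemma odd_ups_interleave x y P Q : size P = size Q ->
  odd_ups (x :: interleave P Q ++ [:: y]) = (x == U) + count_mem D Q.
Proof.
elim: P Q x => [|p P IH] [|q Q] x //= [sPQ].
rewrite /interleave /= -/(interleave _ _) odd_ups_cons2 IH //.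
by congr (_ + (_ + _)); case: q.
Qed.

Lemma never_below_interleave {P Q} : size P = size Q ->
  never_below P Q <->
  forall j, j <= size (interleave P Q) ->
    (0 <= 1 + height (take j (interleave P Q)))%R.
Proof.
move=> sPQ; rewrite size_interleave //.
have sT i : size (take i P) = size (take i Q) by rewrite !size_take_min sPQ.
split=> [nb j hj | pos i hi].
  have even i : i <= size P -> (0 <= height (take (2 * i) (interleave P Q)))%R.
    by move=> hi; rewrite take_interleave height_interleave //; have := nb i hi; lia.
  have [k [ej|ej]] : exists k, j = 2 * k \/ j = (2 * k).+1 by exists j./2; lia.
    by have := even k; rewrite ej; lia.
  (* One step past an even prefix costs at most 1, which the summand 1 absorbs. *)
  by have := even k; have := height_take_succ (interleave P Q) (2 * k); rewrite ej; lia.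
have := pos (2 * i) ltac:(lia).
(* [height_size] exposes the parity: the difference [d] of the two heights is even, so [0 <= 1 + d]
   forces [0 <= d]. *)
by rewrite take_interleave height_interleave // !height_size sT; lia.
Qed.

Lemma labelle_mergeE P Q : labelle_merge (P, Q) = U :: interleave P Q ++ [:: D].
Proof. by []. Qed.

(** The prefix of length 1 and the prefix lacking only the last letter have nonnegative height,
    while the whole word has height 0. *)
Lemma dyck_ends {m w} : 0 < m -> dyck m w -> exists v, w = U :: v ++ [:: D].
Proof.
move=> m0 [fd pos]; have sw := free_dyck_size fd; have h0 := height_free_dyck fd.
case: w => [|x w] in fd pos sw h0 *; first by move: sw => /=; lia.
case/lastP: w => [|v y] in fd pos sw h0 *; first by move: sw => /=; lia.
have := pos 1 isT; have := pos (size v).+1.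
rewrite /= size_rcons take0 -cats1 take_size_cat // => /(_ ltac:(lia)) hx.
move: h0; rewrite -cats1 -cat_cons height_cat.
by case: x y hx {fd pos sw} => [] [] hx;
  first [by exists v | move: hx; rewrite /height /= ?eq_stepE; lia].
Qed.

Lemma dyck_interleave {n P Q} : size P = size Q ->
  dyck n.+1 (U :: interleave P Q ++ [:: D]) <->
  free_dyck n (interleave P Q) /\ never_below P Q.
Proof.
move=> sPQ; rewrite (never_below_interleave sPQ); set v := interleave P Q.
have fdE : free_dyck n.+1 (U :: v ++ [:: D]) <-> free_dyck n v.
  by rewrite /free_dyck /= !count_cat /= ?eq_stepE; split; lia.
rewrite /dyck fdE; split=> -[fd pos]; split=> //.
  move=> j hj; have := pos j.+1; rewrite /= size_cat ltnS => /(_ ltac:(lia)).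
  by rewrite takel_cat // height_cons.
move=> [_|j]; first by rewrite take0.
(* Only the full word contains the final [D], and its height is 0; every other nonempty prefix is
   [U] followed by a prefix of [v]. *)
rewrite /= size_cat addn1 ltnS leq_eqVlt => /orP[/eqP->|hj].
  by rewrite take_oversize ?size_cat ?addn1 // (height_free_dyck (proj2 fdE fd)).
by rewrite takel_cat // height_cons; exact: pos.
Qed.

Theorem theorem3p1 (n : nat) (hn : 0 < n) :
  set_bij (noncrossing_pairs n) (dyck_odd_ups (2 * n + 1) (n + 1)) labelle_merge.
Proof.
split.
- move=> [P Q] [/= fP fQ nb]; rewrite labelle_mergeE.
  have sPQ : size P = size Q by rewrite !(@free_dyck_size n).
  case: fP fQ => [UP DP] [UQ DQ]; split; last by rewrite odd_ups_interleave // DQ addnC.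
  rewrite addn1; apply/dyck_interleave => //; split=> //.
  by split; rewrite (count_U_interleave, count_D_interleave) //; lia.
- move=> [P Q] [P' Q']; rewrite !inE => -[/= /free_dyck_size sP /free_dyck_size sQ _].
  move=> -[/= /free_dyck_size sP' /free_dyck_size sQ' _]; rewrite !labelle_mergeE.
  move=> -[]; rewrite !cats1 => /rcons_inj[eqM].
  by have [-> ->] : P = P' /\ Q = Q' by apply: interleave_inj eqM; lia.
- move=> w [dw ow]; have [v ew] := @dyck_ends (2 * n + 1) w ltac:(lia) dw.
  have sv : size v = 2 * (2 * n).
    by have := free_dyck_size (proj1 dw); rewrite ew /= size_cat /=; lia.
  have [P [Q [sP sQ ev]]] := interleave_surj sv.
  have sPQ : size P = size Q by lia.
  rewrite {}ew {}ev in dw ow *.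
  move: ow dw; rewrite odd_ups_interleave // !addn1 => cQ /(dyck_interleave sPQ).
  rewrite /free_dyck count_U_interleave // count_D_interleave // => -[[cU cD] nb].
  have csP := count_steps P; have csQ := count_steps Q.
  (* Besides the initial [U], the [n] remaining odd up steps are the flipped [D]s of [Q]. The
     [2 * n] letters [U] of the interleaving then leave [n] for [P], and the lengths [2 * n] give
     the other two counts. *)
  have cDQ : count_mem D Q = n by case: cQ.
  have [cUP cDP cUQ] : [/\ count_mem U P = n, count_mem D P = n & count_mem U Q = n].
    by split; lia.
  by exists (P, Q).
Qed.
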